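(* Let $0<\theta<1$ and $Y_\theta:=(\mathcal D(C),\mathcal D(C^2))_{\theta,1}$. Assume that there are constants $K,M_R,M_{P,\theta}>0$ and $\omega_R,\omega_{P,\theta}\in\mathbb R$ such that for all $0<h\le h_0$ and all integers $m\ge 0$: (A1) $\|R_h-P_h\|_{\mathcal L(Y_\theta,\mathcal E_p)}\le K h^{1+\theta}$; (A2) $\|R_h^m\|_{\mathcal L(\mathcal E_p)}\le M_R e^{\omega_R mh}$, and $P_h^m$ maps $Y_\theta$ boundedly into itself with $\|P_h^m\|_{\mathcal L(Y_\theta)}\le M_{P,\theta}e^{\omega_{P,\theta}mh}$. Then for every $T>0$ there exists $K_T>0$ such that $$\|R_h^n-P_h^n\|_{\mathcal L(Y_\theta,\mathcal E_p)}\le K_T h^\theta$$ for all $0<h\le h_0$ and all integers $n\ge 0$ with $nh\le T$.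
   Context: Let $X$ be a Banach space, $\tau<0$, $1<p<\infty$, and $\mathcal E_p:=X\oplus L^p([\tau,0];X)$ with norm $\|(u,\rho)\|_{\mathcal E_p}=\|u\|_X+\|\rho\|_{L^p}$. The transport operator is $C(u,\rho):=(0,\partial_\sigma\rho)$ with domain $\mathcal D(C):=\{(u,\rho)\in X\oplus W^{1,p}([\tau,0];X):\rho(0)=u\}$; its resolvent $S_h^C:=(I-hC)^{-1}\in\mathcal L(\mathcal E_p)$ exists for every $h>0$. $\mathcal D(C)$ carries the graph norm $\|x\|_{\mathcal E_p}+\|Cx\|_{\mathcal E_p}$, and $\mathcal D(C^2)=\{x\in\mathcal D(C):Cx\in\mathcal D(C)\}$ carries the norm $\|x\|_{\mathcal E_p}+\|Cx\|_{\mathcal E_p}+\|C^2x\|_{\mathcal E_p}$. $(\cdot,\cdot)_{\theta,1}$ denotes real interpolation. Let $D:\mathcal D(C)\to\mathcal E_p$ be a (time-independent) linear operator and set $H_h:=hDS_h^C$. Assume operational smallness: there are $h_0>0$ and $q\in(0,1)$ with $\|H_h\|_{\mathcal L(\mathcal E_p)}\le q$ for $0<h\le h_0$. For $0<h\le h_0$ define the implicit Euler step $R_h:=(I-h(C+D))^{-1}$ (with $\mathcal D(C+D)=\mathcal D(C)$), assumed to exist in $\mathcal L(\mathcal E_p)$, and the splitting step $P_h:=(I-H_h)^{-1}S_h^C$. *)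

(* Defs.v *)
From HB Require Import structures.
From mathcomp Require Import all_boot all_order all_algebra.
From mathcomp Require Import generic_quotient ring_quotient.
From mathcomp Require Import all_classical all_reals all_analysis measurable_realfun.

Set Implicit Arguments.
Unset Strict Implicit.
Unset Printing Implicit Defensive.

Import Order.TTheory GRing.Theory Num.Theory.
Import numFieldNormedType.Exports.

Local Open Scope classical_set_scope.
Local Open Scope ring_scope.
Local Open Scope quotient_scope.

Section StronglyMeasurable.
Context {d : measure_display} {T : measurableType d} {R : realType}
        {X : normedModType R}.

Definition measurable_simple (s : {fimfun T >-> X}) : Prop :=
  forall x : X, measurable (s @^-1` [set x]).

(* Every a.e. limit of simple functions is a.e. equal to a function that is an
   everywhere limit, so requiring convergence at every point gives the same
   a.e. classes and keeps measurability independent of the measure. *)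
Definition strongly_measurable (f : T -> X) : Prop :=
  exists2 s : nat -> {fimfun T >-> X},
    (forall n, measurable_simple (s n)) &
    (forall t, s n t @[n --> \oo] --> f t).

Lemma measurable_simple_preimage (s : {fimfun T >-> X}) (A : set X) :
  measurable_simple s -> measurable (s @^-1` A).
Proof.
move=> ms.
have -> : s @^-1` A = \bigcup_(x in range s `&` A) (s @^-1` [set x]).
  apply/seteqP; split=> [t /= At|t [x [_ Ax] /= ->]//].
  by exists (s t) => //; split => //; exists t.
apply: fin_bigcup_measurable => [|x _]; last exact: ms.
by apply: finite_setIl; exact: fimfunP.
Qed.

Lemma measurable_simpleD (s1 s2 : {fimfun T >-> X}) :
  measurable_simple s1 -> measurable_simple s2 -> measurable_simple (s1 + s2).
Proof.
move=> m1 m2 y.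
have -> : (s1 + s2) @^-1` [set y] = \bigcup_(x in range s1)
    (s1 @^-1` [set x] `&` s2 @^-1` [set z | x + z = y]).
  apply/seteqP; split=> [t /= sy|t [x _ [/= <-]]//].
  by exists (s1 t) => //; exists t.
apply: fin_bigcup_measurable => [|x _]; first exact: fimfunP.
by apply: measurableI; [exact: m1|exact: measurable_simple_preimage].
Qed.

Lemma measurable_simpleZ (a : R) (s : {fimfun T >-> X}) :
  measurable_simple s ->
  measurable_simple [fimfun of ( *:%R a : X -> X) \o s].
Proof. by move=> ms y; rewrite comp_preimage; exact: measurable_simple_preimage. Qed.

Lemma strongly_measurable0 : strongly_measurable (0 : T -> X).
Proof.
exists (fun=> cst_fimfun 0) => [n x|t]; last exact: cvg_cst.
by rewrite preimage_cst; case: ifP.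
Qed.

Lemma strongly_measurableD (f g : T -> X) :
  strongly_measurable f -> strongly_measurable g -> strongly_measurable (f + g).
Proof.
move=> [s ms sf] [u mu ug]; exists (fun n => s n + u n) => [n|t].
  exact: measurable_simpleD.
by apply: cvgD; [exact: sf|exact: ug].
Qed.

Lemma strongly_measurableZ (a : R) (f : T -> X) :
  strongly_measurable f -> strongly_measurable (a *: f).
Proof.
move=> [s ms sf]; exists (fun n => [fimfun of ( *:%R a : X -> X) \o s n]) => [n|t].
  exact: measurable_simpleZ.
by apply: cvgZl_tmp; exact: sf.
Qed.

Lemma strongly_measurable_norm (f : T -> X) :
  strongly_measurable f -> measurable_fun [set: T] (fun t => `|f t|).
Proof.
move=> [s ms sf]; apply: (@measurable_fun_cvg _ _ _ _ (fun n t => `|s n t|)).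
  move=> n _ B mB; rewrite setTI.
  by rewrite (_ : _ @^-1` _ = s n @^-1` [set x | B `|x|])//;
    exact: measurable_simple_preimage.
by move=> t _; apply: cvg_norm; exact: sf.
Qed.

End StronglyMeasurable.

Section BochnerIntegral.
Context {d : measure_display} {T : measurableType d} {R : realType}
        {X : normedModType R}.
Variable mu : {measure set T -> \bar R}.

Definition simple_integral (s : {fimfun T >-> X}) : X :=
  \sum_(x \in range s) fine (mu (s @^-1` [set x])) *: x.

(* In simple_integral, [fine] discards infinite masses: for an integrable simple
   function only the level set of 0 can have infinite mass. *)
Definition is_bochner_integral (f : T -> X) (v : X) : Prop :=
  strongly_measurable f /\
  exists s : nat -> {fimfun T >-> X},
    [/\ forall n, measurable_simple (s n),
        forall n, (\int[mu]_t `|s n t|%:E < +oo)%E,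
        (\int[mu]_t `|f t - s n t|%:E)%E @[n --> \oo] --> 0%E
      & simple_integral (s n) @[n --> \oo] --> v].

(* 0 when f is not Bochner integrable *)
Definition bochner_integral (f : T -> X) : X :=
  xget 0 [set v | is_bochner_integral f v].

End BochnerIntegral.

Section BochnerLpFun.
Context {d : measure_display} {T : measurableType d} {R : realType}.
Variables (X : normedModType R) (mu : {measure set T -> \bar R}).
Variable p : R.

Definition lpnorm_fun (f : T -> X) : \bar R :=
  'N[mu]_p%:E[EFin \o (fun t => `|f t|)%R]%E.

Definition mem_lp (_ : 1 <= p) : {pred T -> X} :=
  mem [set f | strongly_measurable f /\ (lpnorm_fun f < +oo)%E].

Variable p1 : 1 <= p.

Let p0 : 0 < p. Proof. exact: lt_le_trans p1. Qed.

Let mpow (f : T -> X) : strongly_measurable f ->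
  measurable_fun [set: T] (fun t => `| `|f t|%:E | `^ p)%E.
Proof.
move=> /strongly_measurable_norm mf.
apply: (@measurableT_comp _ _ _ _ _ _ (fun x => x `^ p)%E) => //=.
  exact: (measurableT_comp (measurable_poweR _)).
by apply/measurable_EFinP; exact: measurableT_comp.
Qed.

Lemma lpnorm_funE (f : T -> X) :
  lpnorm_fun f = ((\int[mu]_t `| `|f t|%:E | `^ p) `^ p^-1)%E.
Proof. by rewrite /lpnorm_fun unlock. Qed.

Lemma lpnorm_fun_ge0 f : (0 <= lpnorm_fun f)%E.
Proof. exact: Lnorm_ge0. Qed.

Lemma lpnorm_fun0 : lpnorm_fun 0 = 0%E.
Proof.
rewrite /lpnorm_fun (_ : _ \o _ = cst 0%E).
  by rewrite Lnorm0// eqe gt_eqF.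
by apply/funext => t /=; rewrite normr0.
Qed.

Lemma lpnorm_funD f g : strongly_measurable f -> strongly_measurable g ->
  (lpnorm_fun (f + g)%R <= lpnorm_fun f + lpnorm_fun g)%E.
Proof.
move=> mf mg.
have mnf := strongly_measurable_norm mf; have mng := strongly_measurable_norm mg.
apply: le_trans (minkowski_EFin mu mnf mng p1).
rewrite lpnorm_funE unlock /Lnorm; apply: gt0_ler_poweR.
- by rewrite invr_ge0 ltW.
- by rewrite in_itv/= leey integral_ge0// => t _; rewrite poweR_ge0.
- by rewrite in_itv/= leey integral_ge0// => t _; rewrite poweR_ge0.
apply: ge0_le_integral => //.
- by move=> t _; rewrite poweR_ge0.
- by apply: mpow; exact: strongly_measurableD.
- apply: (@measurableT_comp _ _ _ _ _ _ (fun x => x `^ p)%E) => //=.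
    exact: (measurableT_comp (measurable_poweR _)).
  apply/measurable_EFinP; apply: measurableT_comp => //.
  exact: measurable_funD.
move=> t _; apply: gt0_ler_poweR; first exact: ltW.
- by rewrite in_itv/= leey lee_fin normr_ge0.
- by rewrite in_itv/= leey lee_fin normr_ge0.
by rewrite lee_fin normr_id [leRHS]ger0_norm ?addr_ge0// ler_normD.
Qed.

Lemma lpnorm_funZ a f : strongly_measurable f ->
  (lpnorm_fun (a *: f)%R = `|a|%:E * lpnorm_fun f)%E.
Proof.
move=> mf; rewrite !lpnorm_funE.
rewrite (@eq_integral _ _ _ mu setT
  (fun t => (`|a| `^ p)%:E * `| `|f t|%:E | `^ p)%E); last first.
  by move=> t _ /=; rewrite normrZ normrM normr_id powRM// EFinM.
rewrite ge0_integralZl//; last 2 first.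
- exact: mpow.
- by move=> t _; rewrite poweR_ge0.
rewrite poweRM ?lee_fin ?powR_ge0//; last first.
  by apply: integral_ge0 => t _; rewrite poweR_ge0.
by rewrite poweR_EFin -powRrM mulfV ?gt_eqF// powRr1.
Qed.

Lemma lpnorm_fun_ae f g : strongly_measurable f -> strongly_measurable g ->
  {ae mu, forall t, f t = g t} -> lpnorm_fun f = lpnorm_fun g.
Proof.
move=> mf mg fg; rewrite !lpnorm_funE; congr (_ `^ _)%E.
apply: ae_eq_integral => //; [exact: mpow|exact: mpow|].
by apply: filterS fg => t -> _.
Qed.

Lemma lpnorm_fun_eq0 f : strongly_measurable f -> lpnorm_fun f = 0%E ->
  {ae mu, forall t, f t = 0}.
Proof.
move=> /strongly_measurable_norm mf /Lnorm_eq0_eq0; rewrite lte_fin => /(_ _ p0).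
have /[swap]/[apply] : measurable_fun setT (EFin \o (fun t => `|f t|)).
  exact/measurable_EFinP.
by apply: filterS => t /(_ I) [] /eqP; rewrite normr_eq0 => /eqP.
Qed.

Lemma mem_lp_submod_closed : submod_closed (mem_lp p1).
Proof.
split.
  apply/mem_set; split; first exact: strongly_measurable0.
  by rewrite lpnorm_fun0.
move=> a f g /set_mem[mf nf] /set_mem[mg ng]; apply/mem_set.
have maf : strongly_measurable (a *: f) by exact: strongly_measurableZ.
split; first exact: strongly_measurableD.
apply: (le_lt_trans (lpnorm_funD _ _)) => //.
by rewrite lte_add_pinfty// lpnorm_funZ// lte_mul_pinfty// lee_fin.
Qed.

HB.instance Definition _ :=
  GRing.isSubmodClosed.Build R (T -> X) (mem_lp p1) mem_lp_submod_closed.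

Record lpfun := LpFun { lpfun_val :> T -> X; lpfunP : lpfun_val \in mem_lp p1 }.

HB.instance Definition _ := [isSub for lpfun_val].
HB.instance Definition _ := [Choice of lpfun by <:].
HB.instance Definition _ := [SubChoice_isSubLmodule of lpfun by <:].

Lemma lpfun_measurable (f : lpfun) : strongly_measurable f.
Proof. by have /set_mem[] := lpfunP f. Qed.

Definition ae_zero : {pred lpfun} :=
  mem [set f : lpfun | {ae mu, forall t, f t = 0}].

Lemma ae_zero_zmod_closed : zmod_closed ae_zero.
Proof.
split; first by apply/mem_set; exact: nearW.
move=> f g /set_mem f0 /set_mem g0; apply/mem_set.
by apply: filterS2 f0 g0 => t f0 g0; rewrite [LHS]/= -[LHS]/(f t - g t) f0 g0 subrr.
Qed.

HB.instance Definition _ :=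
  GRing.isZmodClosed.Build lpfun ae_zero ae_zero_zmod_closed.

End BochnerLpFun.

Arguments ae_zero {d T R} X mu {p} p1 _.
Section BochnerLp.
Context {d : measure_display} {T : measurableType d} {R : realType}.
Variables (X : normedModType R) (mu : {measure set T -> \bar R}).
Variables (p : R) (p1 : 1 <= p).

Definition Lp : Type := Quotient.quot (ae_zero X mu p1 : zmodClosed _).

HB.instance Definition _ := GRing.Zmodule.on Lp.
HB.instance Definition _ := EqQuotient.on Lp.

Lemma pi_LpP (f g : lpfun X mu p1) :
  \pi_Lp f = \pi_Lp g <-> {ae mu, forall t, f t = g t}.
Proof.
have -> : (\pi_Lp f = \pi_Lp g) <-> f - g \in ae_zero X mu p1.
  rewrite (Quotient.idealrBE (ae_zero X mu p1 : zmodClosed _)).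
  by split=> [->|/eqP].
split=> [/set_mem fg|fg]; last apply/mem_set.
  by apply: filterS fg => t /eqP; rewrite [X in X == _]/= subr_eq0 => /eqP.
by apply: filterS fg => t fg; rewrite -[LHS]/(f t - g t) fg subrr.
Qed.

Lemma pi_LpD (f g : lpfun X mu p1) : \pi_Lp (f + g) = \pi_Lp f + \pi_Lp g.
Proof. exact: (@Quotient.pi_add _ (ae_zero X mu p1 : zmodClosed _)). Qed.

Lemma repr_LpK (f : lpfun X mu p1) : {ae mu, forall t, repr (\pi_Lp f) t = f t}.
Proof. by apply/pi_LpP; rewrite reprK. Qed.

Definition Lp_scale (a : R) (x : Lp) : Lp := \pi_Lp (a *: (repr x : lpfun X mu p1)).

Lemma pi_LpZ a (f : lpfun X mu p1) : \pi_Lp (a *: f) = Lp_scale a (\pi_Lp f).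
Proof.
apply/pi_LpP; apply: filterS (repr_LpK f) => t ft.
by rewrite -[RHS]/(a *: (repr (\pi_Lp f) : lpfun X mu p1) t) ft.
Qed.

Lemma Lp_scaleA a b x : Lp_scale a (Lp_scale b x) = Lp_scale (a * b) x.
Proof. by elim/quotW: x => f; rewrite -(pi_LpZ b f) -!pi_LpZ scalerA. Qed.

Lemma Lp_scale1 : left_id 1 Lp_scale.
Proof. by elim/quotW => f; rewrite -pi_LpZ scale1r. Qed.

Lemma Lp_scaleDr : right_distributive Lp_scale +%R.
Proof.
by move=> a; elim/quotW => f; elim/quotW => g; rewrite -pi_LpD -!pi_LpZ -pi_LpD scalerDr.
Qed.

Lemma Lp_scaleDl x : {morph Lp_scale^~ x : a b / a + b}.
Proof.
by move=> a b; elim/quotW: x => f; rewrite -!pi_LpZ -pi_LpD scalerDl.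
Qed.

HB.instance Definition _ :=
  GRing.Zmodule_isLmodule.Build R Lp Lp_scaleA Lp_scale1 Lp_scaleDr Lp_scaleDl.

Definition Lp_fun (x : Lp) : T -> X := (repr x : lpfun X mu p1).

Definition Lp_norm (x : Lp) : R := fine (lpnorm_fun mu p (Lp_fun x)).

Lemma Lp_norm_pi (f : lpfun X mu p1) : (Lp_norm (\pi_Lp f))%:E = lpnorm_fun mu p f.
Proof.
rewrite /Lp_norm fineK; last first.
  by rewrite ge0_fin_numE ?lpnorm_fun_ge0//; have /set_mem[] := lpfunP (repr (\pi_Lp f)).
by apply: lpnorm_fun_ae (repr_LpK f) => //; exact: lpfun_measurable.
Qed.

Lemma Lp_normD x y : Lp_norm (x + y) <= Lp_norm x + Lp_norm y.
Proof.
elim/quotW: x => f; elim/quotW: y => g; rewrite -pi_LpD -lee_fin EFinD !Lp_norm_pi.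
by apply: lpnorm_funD => //; exact: lpfun_measurable.
Qed.

Lemma Lp_normZ a x : Lp_norm (a *: x) = `|a| * Lp_norm x.
Proof.
elim/quotW: x => f; rewrite -[_ *: _]pi_LpZ; apply: EFin_inj.
by rewrite EFinM !Lp_norm_pi; apply: lpnorm_funZ => //; exact: lpfun_measurable.
Qed.

Lemma Lp_norm_eq0 x : Lp_norm x = 0 -> x = 0.
Proof.
elim/quotW: x => f nf0; have := congr1 EFin nf0; rewrite Lp_norm_pi => f0.
have -> : 0 = \pi_Lp 0 :> Lp.
  by apply: (@addrI _ (\pi_Lp 0)); rewrite addr0 -pi_LpD addr0.
by apply/pi_LpP; apply: lpnorm_fun_eq0 f0 => //; exact: lpfun_measurable.
Qed.

HB.instance Definition _ :=
  Lmodule_isNormed.Build R Lp Lp_normD Lp_normZ Lp_norm_eq0.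

End BochnerLp.

Section NormedSubspaces.
Context {R : realType} {E : lmodType R}.

Record normed_subspace :=
  NormedSubspace { ns_set :> set E; ns_norm : E -> R }.

Definition linear_on (V : set E) (A : E -> E) : Prop :=
  forall (a : R) x y, V x -> V y -> A (a *: x + y) = a *: A x + A y.

Definition maps_into (V W : set E) (A : E -> E) : Prop :=
  forall x, V x -> W (A x).

(* The norm of L(V, W), with value +oo when A is unbounded from V to W. *)
Definition opnorm (V W : normed_subspace) (A : E -> E) : \bar R :=
  ereal_inf [set c%:E | c in [set c : R |
    0 <= c /\ forall x, ns_set V x -> ns_norm W (A x) <= c * ns_norm V x]].

Definition bounded_operator (V W : normed_subspace) (A : E -> E) : Prop :=
  [/\ linear_on V A, maps_into V W A & (opnorm V W A < +oo)%E].

Definition invertible_on (V : set E) (A : E -> E) : Prop :=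
  forall y, exists! x, V x /\ A x = y.

(* The inverse of A restricted to V, as a total function: the value is 0 at points
   that A does not reach from V. *)
Definition inverse_on (V : set E) (A : E -> E) (y : E) : E :=
  xget 0 [set x | V x /\ A x = y].

Definition K_functional (V W : normed_subspace) (t : R) (x : E) : R :=
  inf [set r | exists v w,
    [/\ ns_set V v, ns_set W w, v + w = x & r = ns_norm V v + t * ns_norm W w]].

(* K-method with second index 1: x |-> int_0^oo t^(-theta) K(t, x) dt/t *)
Definition interpolation_enorm (theta : R) (V W : normed_subspace) (x : E) :
    \bar R :=
  \int[@lebesgue_measure R]_(t in `]0, +oo[)
    ((t `^ (- theta) * K_functional V W t x) / t)%:E.

Definition interpolation1 (theta : R) (V W : normed_subspace) :
    normed_subspace :=
  NormedSubspace
    [set x | (exists v w, [/\ ns_set V v, ns_set W w & v + w = x]) /\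
             (interpolation_enorm theta V W x < +oo)%E]
    (fun x => fine (interpolation_enorm theta V W x)).

End NormedSubspaces.

Definition whole_space {R : realType} (E : normedModType R) :
    @normed_subspace R E :=
  NormedSubspace [set: E] (fun x => `|x|).

Section HistorySpace.
Context {R : realType}.
Variables (X : normedModType R) (tau : R).

(* Functions on [tau, 0] are represented by functions on R; the measure only
   sees their values on [tau, 0]. *)
Definition history_measure :=
  mrestr (@lebesgue_measure R) (measurable_itv `[tau, 0]).

HB.instance Definition _ := Measure.on history_measure.

Variables (p : R) (p1 : 1 <= p).

(* The Lmodule structure alone is inherited from the product: the library norm on
   products is the maximum, whereas this space carries the sum of the norms. *)
Definition history_space : Type := (X * Lp X history_measure p1)%type.

HB.instance Definition _ := GRing.Lmodule.on history_space.

Definition history_norm (x : history_space) : R := `|x.1| + `|x.2|.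

Lemma history_normD x y :
  history_norm (x + y) <= history_norm x + history_norm y.
Proof. by rewrite /history_norm addrACA lerD// ler_normD. Qed.

Lemma history_normZ a x : history_norm (a *: x) = `|a| * history_norm x.
Proof. by rewrite /history_norm !normrZ mulrDr. Qed.

Lemma history_norm_eq0 x : history_norm x = 0 -> x = 0.
Proof.
case: x => u rho /eqP; rewrite paddr_eq0// !normr_eq0 => /andP[/eqP/= -> /eqP/= ->].
by [].
Qed.

HB.instance Definition _ := Lmodule_isNormed.Build R history_space
  history_normD history_normZ history_norm_eq0.

Definition test_function (phi : R -> R) : Prop :=
  (forall n t, derivable (derive1n n phi) t 1) /\
  exists a b, [/\ tau < a, b < 0 & forall t, phi t != 0 -> a <= t <= b].

(* For rho, g in L^p and phi a test function, both integrands are Bochner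
   integrable because history_measure is finite. *)
Definition is_weak_derivative (rho g : Lp X history_measure p1) : Prop :=
  forall phi : R -> R, test_function phi ->
    bochner_integral history_measure (fun t => derive1 phi t *: Lp_fun rho t) =
    - bochner_integral history_measure (fun t => phi t *: Lp_fun g t).

Definition sobolev1 : set (Lp X history_measure p1) :=
  [set rho | exists g, is_weak_derivative rho g].

Definition weak_derivative (rho : Lp X history_measure p1) :
    Lp X history_measure p1 :=
  xget 0 [set g | is_weak_derivative rho g].

(* u is the value at 0 of the continuous representative of rho *)
Definition has_trace0 (rho : Lp X history_measure p1) (u : X) : Prop :=
  exists r : R -> X,
    [/\ {within `[tau, 0], continuous r},
        {ae history_measure, forall t, Lp_fun rho t = r t} & r 0 = u].

(* The value is meaningful on domain_transport only. *)
Definition transport (x : history_space) : history_space :=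
  (0, weak_derivative x.2).

Definition domain_transport : set history_space :=
  [set x | sobolev1 x.2 /\ has_trace0 x.2 x.1].

Definition graph_transport : normed_subspace :=
  NormedSubspace domain_transport (fun x => `|x| + `|transport x|).

Definition graph_transport2 : normed_subspace :=
  NormedSubspace
    [set x | domain_transport x /\ domain_transport (transport x)]
    (fun x => `|x| + `|transport x| + `|transport (transport x)|).

(* (I - h C)^-1 with C = transport *)
Definition resolvent (h : R) : history_space -> history_space :=
  inverse_on domain_transport (fun x => x - h *: transport x).

(* Only the values of D on domain_transport matter. *)
Variable D : history_space -> history_space.

Definition perturbation_step (h : R) (x : history_space) : history_space :=
  h *: D (resolvent h x).

Definition euler_step (h : R) : history_space -> history_space :=
  inverse_on domain_transport (fun x => x - h *: (transport x + D x)).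

(* (I - H_h)^-1 S_h with H_h = perturbation_step h and S_h = resolvent h *)
Definition splitting_step (h : R) (x : history_space) : history_space :=
  inverse_on [set: history_space] (fun y => y - perturbation_step h y)
    (resolvent h x).

End HistorySpace.

(* Main.v *)
(* Writing R and P for the Euler and the splitting step, the error telescopes as
   R^n - P^n = sum_(i < n) R^(n-1-i) (R - P) P^i. By (A2) each P^i is bounded on
   Y and each R^(n-1-i) on E, uniformly while n h <= T, so by (A1) each summand
   is O(h^(1+theta)); there are n <= T / h of them. *)
Require Import Defs.
From mathcomp Require Import all_boot all_order all_algebra.
From mathcomp Require Import all_classical all_reals all_analysis.
From mathcomp Require Import ring.

Set Implicit Arguments.
Unset Strict Implicit.
Unset Printing Implicit Defensive.

Import Order.TTheory GRing.Theory Num.Theory.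
Import numFieldNormedType.Exports.

Local Open Scope classical_set_scope.
Local Open Scope ring_scope.

(** Induction on [n] with [x] general: the term [iter n A (B x)] is inserted, so that the first
    difference is [iter n A (A x - B x)] by additivity and the second is the induction hypothesis at
    [B x]. For [n = 0] the sum is empty, so the truncated [n.-1] is harmless. *)
Lemma iter_sub_telescope (E : zmodType) (A B : E -> E) (n : nat) (x : E) :
  {morph A : y z / y - z} ->
  iter n A x - iter n B x =
  \sum_(i < n) iter (n.-1 - i) A (A (iter i B x) - B (iter i B x)).
Proof.
move=> AB; elim: n x => [|n IHn] x; first by rewrite big_ord0 subrr.
have iterB m : {morph iter m A : y z / y - z}.
  by elim: m => // m IHm y z; rewrite /= IHm AB.
rewrite big_ord_recl subn0 /= -!iterS !iterSr iterB.
rewrite -[LHS](subrKA (iter n A (B x))) IHn; congr +%R.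
apply: eq_bigr => i _; rewrite -!iterSr /=.
by rewrite add0n /bump leq0n add1n subnS -!subn1 subnAC.
Qed.

Section OperatorNorm.
Context {R : realType} {E : lmodType R}.
Implicit Types (V W : @normed_subspace R E) (A : E -> E) (c : R) (x : E).

(** The infimum defining [opnorm] is attained: at a fixed [x], admissible constants arbitrarily
    close to [c] give the estimate with [c] in the limit. *)
Lemma opnorm_leP V W A c :
  0 <= c -> (forall x, ns_set V x -> 0 <= ns_norm V x) ->
  (opnorm V W A <= c%:E)%E <->
  forall x, ns_set V x -> ns_norm W (A x) <= c * ns_norm V x.
Proof.
move=> c0 V0; split=> [Ac x Vx|Ac]; last by apply: ereal_inf_lbound; exists c.
apply/ler_addgt0Pr => e e0.
(* The added 1 keeps the divisor positive when the norm of [x] vanishes; the excess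
   [e / (ns_norm V x + 1)] times that norm is still at most [e]. *)
have b0 : 0 < ns_norm V x + 1 by rewrite ltr_wpDl// V0.
have /ereal_inf_lt[_ [c' [_ Ac'] <-]] :
    (opnorm V W A < (c + e / (ns_norm V x + 1))%:E)%E.
  by rewrite (le_lt_trans Ac)// lte_fin ltrDl divr_gt0.
rewrite lte_fin => /ltW c'e; apply: (le_trans (Ac' _ Vx)).
apply: (le_trans (ler_wpM2r (V0 _ Vx) c'e)).
rewrite mulrDl lerD2l -mulrA ger_pMr// mulrC ler_pdivrMr// mul1r.
by rewrite lerDl.
Qed.

Lemma K_functional_ge0 V W (t : R) x : 0 <= t ->
  (forall x, ns_set V x -> 0 <= ns_norm V x) ->
  (forall x, ns_set W x -> 0 <= ns_norm W x) ->
  0 <= K_functional V W t x.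
Proof.
move=> t0 V0 W0; rewrite /K_functional.
(* If [x] has no decomposition, the infimum is 0 by convention. *)
set S := [set r | _]; have [->|S0] := eqVneq S set0; first by rewrite inf0.
apply: lb_le_inf; first exact/set0P.
by move=> _ [v [w [Vv Ww _ ->]]]; rewrite addr_ge0 ?mulr_ge0 ?V0 ?W0.
Qed.

Lemma interpolation1_norm_ge0 (theta : R) V W x :
  (forall x, ns_set V x -> 0 <= ns_norm V x) ->
  (forall x, ns_set W x -> 0 <= ns_norm W x) ->
  0 <= ns_norm (interpolation1 theta V W) x.
Proof.
move=> V0 W0; apply: fine_ge0; apply: integral_ge0 => t /=.
rewrite in_itv/= andbT => /ltW t0.
by rewrite lee_fin divr_ge0// mulr_ge0 ?powR_ge0// K_functional_ge0.
Qed.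

End OperatorNorm.

Theorem theorem5p1 (R : realType) (X : completeNormedModType R) (tau p : R)
    (tau_lt0 : tau < 0) (p_gt1 : 1 < p)
    (D : history_space X tau (ltW p_gt1) -> history_space X tau (ltW p_gt1)) :
  let E := whole_space (history_space X tau (ltW p_gt1)) in
  let domC := @domain_transport R X tau p (ltW p_gt1) in
  forall (D_linear : linear_on domC D)
    (h0 q : R) (h0_gt0 : 0 < h0) (q_gt0 : 0 < q) (q_lt1 : q < 1)
    (smallness : forall h : R, 0 < h <= h0 ->
      bounded_operator E E (perturbation_step D h) /\
      (opnorm E E (perturbation_step D h) <= q%:E)%E)
    (euler_exists : forall h : R, 0 < h <= h0 ->
      invertible_on domC (fun x => x - h *: (transport x + D x)) /\
      bounded_operator E E (euler_step D h))
    (theta : R) (theta_gt0 : 0 < theta) (theta_lt1 : theta < 1),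
  let Y := interpolation1 theta (graph_transport X tau (ltW p_gt1))
             (graph_transport2 X tau (ltW p_gt1)) in
  forall (K M_R M_P omega_R omega_P : R)
    (K_gt0 : 0 < K) (M_R_gt0 : 0 < M_R) (M_P_gt0 : 0 < M_P)
    (A1 : forall h : R, 0 < h <= h0 ->
      (opnorm Y E (fun x => (euler_step D h x - splitting_step D h x)%R)
       <= (K * h `^ (1 + theta))%:E)%E)
    (A2 : forall (h : R) (m : nat), 0 < h <= h0 ->
      [/\ (opnorm E E (iter m (euler_step D h))
           <= (M_R * expR (omega_R * m%:R * h))%:E)%E,
          bounded_operator Y Y (iter m (splitting_step D h)) &
          (opnorm Y Y (iter m (splitting_step D h))
           <= (M_P * expR (omega_P * m%:R * h))%:E)%E])
    (T : R) (T_gt0 : 0 < T),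
  exists2 K_T : R, 0 < K_T &
    forall (h : R) (n : nat), 0 < h <= h0 -> n%:R * h <= T ->
      (opnorm Y E (fun x =>
         (iter n (euler_step D h) x - iter n (splitting_step D h) x)%R)
       <= (K_T * h `^ theta)%:E)%E.
Proof.
move=> E domC D_linear h0 q h0_gt0 q_gt0 q_lt1 smallness euler_exists.
move=> theta theta_gt0 theta_lt1 Y K M_R M_P omega_R omega_P.
move=> K_gt0 M_R_gt0 M_P_gt0 A1 A2 T T_gt0.
have Y0 x : ns_set Y x -> 0 <= ns_norm Y x.
  by move=> _; apply: interpolation1_norm_ge0 => z _ /=; rewrite !addr_ge0.
have E0 x : ns_set E x -> 0 <= ns_norm E x by move=> _ /=.
(* Stability constants uniform over all [m] with [m h <= T]; absolute values cover negative growth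
   rates. *)
set c_R := M_R * expR (`|omega_R| * T); set c_P := M_P * expR (`|omega_P| * T).
have c_R0 : 0 < c_R by rewrite mulr_gt0// expR_gt0.
have c_P0 : 0 < c_P by rewrite mulr_gt0// expR_gt0.
have c0 : 0 < c_R * (K * c_P) by rewrite (mulr_gt0 c_R0)// mulr_gt0.
exists (T * (c_R * (K * c_P))); first exact: mulr_gt0.
move=> h n hh nhT; have /andP[h_gt0 _] := hh.
have le_MexpT (M w : R) m : 0 < M -> (m <= n)%N ->
    M * expR (w * m%:R * h) <= M * expR (`|w| * T).
  move=> M0 mn; rewrite ler_pM2l// ler_expR -mulrA.
  have mh0 : 0 <= m%:R * h by rewrite mulr_ge0// ltW.
  apply: (le_trans (ler_wpM2r mh0 (ler_norm w))).
  by rewrite ler_wpM2l// (le_trans _ nhT)// ler_wpM2r ?ler_nat// ltW.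
have [_ [R_lin _ _]] := euler_exists h hh.
(* Subtraction is the case [a = -1] of linearity on the whole space. *)
have R_sub : {morph euler_step D h : y z / y - z}.
  move=> y z; have := R_lin (-1) z y I I.
  by rewrite !scaleN1r addrC => ->; rewrite addrC.
have R_le m z : (m <= n)%N -> `|iter m (euler_step D h) z| <= c_R * `|z|.
  move=> mn; have [A2R _ _] := A2 h m hh.
  have C0 : 0 <= M_R * expR (omega_R * m%:R * h).
    by rewrite mulr_ge0 ?expR_ge0 ?ltW.
  apply: (le_trans ((opnorm_leP _ _ C0 E0).1 A2R z I)).
  exact: (ler_wpM2r (E0 z I) (le_MexpT _ _ _ M_R_gt0 mn)).
(* Invariance of [Y] matters as much as the bound: (A1) controls the one-step defect on [Y] only. *)
have P_le m x : (m <= n)%N -> ns_set Y x ->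
    ns_set Y (iter m (splitting_step D h) x) /\
    ns_norm Y (iter m (splitting_step D h) x) <= c_P * ns_norm Y x.
  move=> mn Yx; have [_ [_ PY _] A2P] := A2 h m hh; split; first exact: PY.
  have C0 : 0 <= M_P * expR (omega_P * m%:R * h).
    by rewrite mulr_ge0 ?expR_ge0 ?ltW.
  apply: (le_trans ((opnorm_leP _ _ C0 Y0).1 A2P x Yx)).
  exact: (ler_wpM2r (Y0 x Yx) (le_MexpT _ _ _ M_P_gt0 mn)).
have d_le x : ns_set Y x -> `|euler_step D h x - splitting_step D h x|
    <= K * h `^ (1 + theta) * ns_norm Y x.
  have C0 : 0 <= K * h `^ (1 + theta) by rewrite mulr_ge0 ?powR_ge0 ?ltW.
  exact: ((opnorm_leP _ _ C0 Y0).1 (A1 h hh)).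
apply/opnorm_leP => //; first by rewrite mulr_ge0 ?powR_ge0// ltW// mulr_gt0.
move=> x Yx; rewrite [leLHS]/= iter_sub_telescope//.
apply: (le_trans (ler_norm_sum _ _ _)).
apply: (@le_trans _ _ (\sum_(i < n)
    c_R * (K * h `^ (1 + theta) * (c_P * ns_norm Y x)))).
  (* Three estimates from the outside in: Euler stability on [E], the defect from [Y] to [E],
     splitting stability on [Y]. *)
  apply: ler_sum => i _; have [YPx Px_le] := P_le i x (ltnW (ltn_ord i)) Yx.
  apply: (le_trans (R_le _ _ _)).
    by rewrite (leq_trans (leq_subr _ _))// leq_pred.
  apply: (ler_wpM2l (ltW c_R0)); apply: (le_trans (d_le _ YPx)).
  by apply: ler_wpM2l => //; rewrite mulr_ge0 ?powR_ge0 ?ltW.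
rewrite sumr_const card_ord -[leLHS]mulr_natl.
rewrite powRD ?(gt_eqF h_gt0) ?implybT// (powRr1 (ltW h_gt0)).
(* With one factor [h] split off from the power, the sum is [n h b], and [n h <= T] yields the
   constant [T * (c_R * (K * c_P))]. *)
pose b := c_R * (K * c_P) * h `^ theta * ns_norm Y x.
have b0 : 0 <= b by rewrite mulr_ge0 ?Y0// mulr_ge0 ?powR_ge0// ltW.
rewrite [leLHS](_ : _ = n%:R * h * b); last by rewrite /b; ring.
rewrite [leRHS](_ : _ = T * b); last by rewrite /b; ring.
exact: ler_wpM2r.
Qed.
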